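(* Let $\Gamma$ be a well-formed global context (i.e. $\vdash \Gamma$). Then subject reduction holds for $\to_{\beta\Gamma}$ in $\Gamma$: for all terms $t_1,t_2,T$ and every local context $\Delta$ with $\vdash_\Gamma \Delta$, if $\Gamma;\Delta \vdash t_1 : T$ and $t_1 \to_{\beta\Gamma} t_2$, then $\Gamma;\Delta \vdash t_2 : T$.
   Context: The $\lambda\Pi$-calculus modulo. Fix pairwise disjoint infinite sets $\mathrm{Var}$ (variables), $\mathrm{OCst}$ (object constants) and $\mathrm{TCst}$ (type constants). Objects: $t ::= x \mid c \mid t\,t \mid \lambda x:U.t$ ($x$ variable, $c$ object constant, $U$ a type). Types: $U,V ::= C \mid U\,t \mid \lambda x:U.V \mid \Pi x:U.V$ ($C$ type constant, $t$ object). Kinds: $K ::= \mathrm{Type} \mid \Pi x:U.K$. A term is an object, a type, a kind, or the symbol $\mathrm{Kind}$; $\mathrm{Type}$ and $\mathrm{Kind}$ are the sorts, and $s$ ranges over sorts. $A\to B$ abbreviates $\Pi x:A.B$ when $x$ is not free in $B$; $u[x/v]$ is capture-avoiding substitution. A local context is a list of declarations $(x:U)$ with $U$ a type. A global context is a list of object declarations $(c:U)$, type declarations $(C:K)$, and rewrite rules $(u\to v)$ where $u,v$ are both objects or both types. $\beta$-reduction $\to_\beta$ is the smallest relation on (untyped) terms containing $(\lambda x:A.u)v \to u[x/v]$ and closed under subterm rewriting. For a global context $\Gamma$, $\to_\Gamma$ is the smallest relation containing $u\to v$ for each rule $(u\to v)\in\Gamma$, closed under arbitrary (not necessarily well-typed)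 substitution and subterm rewriting. $\to_{\beta\Gamma} = \to_\beta\cup\to_\Gamma$, and $\equiv_{\beta\Gamma}$ is the congruence (reflexive–symmetric–transitive closure) generated by $\to_{\beta\Gamma}$. Typing $\Gamma;\Delta\vdash t:A$ is defined by: (Sort) $\Gamma;\Delta\vdash \mathrm{Type}:\mathrm{Kind}$; (Variable) if $(x:A)\in\Delta$ then $\Gamma;\Delta\vdash x:A$; (Constant) if $(c:A)\in\Gamma$ then $\Gamma;\Delta\vdash c:A$; (Application) from $\Gamma;\Delta\vdash t:\Pi x:A.B$ and $\Gamma;\Delta\vdash u:A$ infer $\Gamma;\Delta\vdash tu : B[x/u]$; (Abstraction) from $\Gamma;\Delta\vdash A:\mathrm{Type}$, $\Gamma;\Delta(x:A)\vdash t:B$ and $B\neq\mathrm{Kind}$ infer $\Gamma;\Delta\vdash\lambda x:A.t:\Pi x:A.B$; (Product) from $\Gamma;\Delta\vdash A:\mathrm{Type}$ and $\Gamma;\Delta(x:A)\vdash B:s$ infer $\Gamma;\Delta\vdash \Pi x:A.B : s$; (Conversion) from $\Gamma;\Delta\vdash t:A$, $\Gamma;\Delta\vdash B:s$ and $A\equiv_{\beta\Gamma}B$ infer $\Gamma;\Delta\vdash t:B$. Well-formed local contexts: $\vdash_\Gamma \emptyset$; if $\vdash_\Gamma\Delta$, $\Gamma;\Delta\vdash U:\mathrm{Type}$ and $x\notin dom(\Delta)$ then $\vdash_\Gamma \Delta(x:U)$. Product compatibility $\mathbf{PC}(\Gamma)$: whenever $\Pi x:A_1.B_1$ and $\Pi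 x:A_2.B_2$ are well-typed in the same well-formed local context and $\Pi x:A_1.B_1\equiv_{\beta\Gamma}\Pi x:A_2.B_2$, then $A_1\equiv_{\beta\Gamma}A_2$ and $B_1\equiv_{\beta\Gamma}B_2$. A rewrite rule $(u\to v)$ is well-typed for $\Gamma$ if for every substitution $\sigma$, every well-formed local context $\Delta$ and term $T$, $\Gamma;\Delta\vdash\sigma(u):T$ implies $\Gamma;\Delta\vdash\sigma(v):T$; it is permanently well-typed for $\Gamma$ if it is well-typed for every global context $\Gamma_0\supseteq\Gamma$ satisfying $\mathbf{PC}(\Gamma_0)$. Well-formed global contexts $\vdash\Gamma$: $\vdash\emptyset$; if $\vdash\Gamma$, $\Gamma;\emptyset\vdash U:\mathrm{Type}$ and $c\notin dom(\Gamma)$ then $\vdash\Gamma(c:U)$; if $\vdash\Gamma$, $\Gamma;\emptyset\vdash K:\mathrm{Kind}$, $\mathbf{PC}(\Gamma(C:K))$ and $C\notin dom(\Gamma)$ then $\vdash\Gamma(C:K)$; if $\vdash\Gamma$, each $(u_i\to v_i)$ ($1\le i\le n$) is permanently well-typed for $\Gamma$, and $\mathbf{PC}(\Gamma(u_1\to v_1)\dots(u_n\to v_n))$, then $\vdash \Gamma(u_1\to v_1)\dots(u_n\to v_n)$.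
   Formalization: In ⊢Γ(c:U), the new object constant c must also not occur in any rewrite rule of Γ; without this the claim fails, e.g. for the rule Πx:A.D c → Πx:A.F given before c:N and d:D c are declared, since (λx:A.d) a : F reduces to d. *)

(* Defs.v *)
(* The lambda-Pi-calculus modulo, over plain Stdlib, with de Bruijn indices. *)
From Stdlib Require Import List Relations FinFun.
Import ListNotations.

Set Implicit Arguments.

Definition infinite (T : Type) : Prop := exists f : nat -> T, Injective f.

Inductive sort : Type := Type_ | Kind_.

Section LambdaPiModulo.

Variables OCst TCst : Type.

(* One type of raw expressions; [is_object], [is_type], [is_kind] below carve
   the grammar out of it.  [Lam A t] and [Pi A B] bind index 0 in their second
   argument, so alpha-equivalence is equality. *)
Inductive expr : Type :=
| Var (x : nat)
| OC (c : OCst)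
| TC (C : TCst)
| Srt (s : sort)
| App (t u : expr)
| Lam (A t : expr)
| Pi (A B : expr).

Inductive is_object : expr -> Prop :=
| object_var x : is_object (Var x)
| object_cst c : is_object (OC c)
| object_app t u : is_object t -> is_object u -> is_object (App t u)
| object_lam U t : is_type U -> is_object t -> is_object (Lam U t)
with is_type : expr -> Prop :=
| type_cst C : is_type (TC C)
| type_app U t : is_type U -> is_object t -> is_type (App U t)
| type_lam U V : is_type U -> is_type V -> is_type (Lam U V)
| type_pi U V : is_type U -> is_type V -> is_type (Pi U V).

Inductive is_kind : expr -> Prop :=
| kind_type : is_kind (Srt Type_)
| kind_pi U K : is_type U -> is_kind K -> is_kind (Pi U K).

Definition is_term (t : expr) : Prop :=
  is_object t \/ is_type t \/ is_kind t \/ t = Srt Kind_.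

Definition up_ren (f : nat -> nat) (x : nat) : nat :=
  match x with 0 => 0 | S y => S (f y) end.

Fixpoint rename (f : nat -> nat) (t : expr) : expr :=
  match t with
  | Var x => Var (f x)
  | OC c => OC c
  | TC C => TC C
  | Srt s => Srt s
  | App t u => App (rename f t) (rename f u)
  | Lam A t => Lam (rename f A) (rename (up_ren f) t)
  | Pi A B => Pi (rename f A) (rename (up_ren f) B)
  end.

Definition lift (n : nat) : expr -> expr := rename (Nat.add n).

Definition scons (v : expr) (sigma : nat -> expr) (x : nat) : expr :=
  match x with 0 => v | S y => sigma y end.

Definition up (sigma : nat -> expr) : nat -> expr :=
  scons (Var 0) (fun x => lift 1 (sigma x)).

Fixpoint subst (sigma : nat -> expr) (t : expr) : expr :=
  match t with
  | Var x => sigma x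
  | OC c => OC c
  | TC C => TC C
  | Srt s => Srt s
  | App t u => App (subst sigma t) (subst sigma u)
  | Lam A t => Lam (subst sigma A) (subst (up sigma) t)
  | Pi A B => Pi (subst sigma A) (subst (up sigma) B)
  end.

Definition subst1 (u v : expr) : expr := subst (scons v Var) u.

(* Variables are objects, so only objects may be substituted for them. *)
Definition is_substitution (sigma : nat -> expr) : Prop :=
  forall x, is_object (sigma x).

Fixpoint closed_at (k : nat) (t : expr) : Prop :=
  match t with
  | Var x => x < k
  | OC _ | TC _ | Srt _ => True
  | App t u => closed_at k t /\ closed_at k u
  | Lam A t => closed_at k A /\ closed_at (S k) t
  | Pi A B => closed_at k A /\ closed_at (S k) B
  end.

Definition closed (t : expr) : Prop := closed_at 0 t.

Fixpoint occurs (c : OCst) (t : expr) : Prop :=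
  match t with
  | OC d => c = d
  | Var _ | TC _ | Srt _ => False
  | App t u => occurs c t \/ occurs c u
  | Lam A t => occurs c A \/ occurs c t
  | Pi A B => occurs c A \/ occurs c B
  end.

(* Index 0 of a local context is its most recent declaration, at the head. *)
Definition lctx : Type := list expr.

(* The free variables of [u] and [v] in [Rule u v] are the pattern variables. *)
Inductive entry : Type :=
| ODecl (c : OCst) (U : expr)
| TDecl (C : TCst) (K : expr)
| Rule (u v : expr).

(* The most recent entry is at the head. *)
Definition gctx : Type := list entry.

Definition rule_syntax (u v : expr) : Prop :=
  (is_object u /\ is_object v) \/ (is_type u /\ is_type v).

Definition entry_syntax (e : entry) : Prop :=
  match e with
  | ODecl _ U => is_type U /\ closed U
  | TDecl _ K => is_kind K /\ closed K
  | Rule u v => rule_syntax u v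
  end.

(* Global contexts that need not be well-formed: the entries follow the
   grammar, declared types are closed, and no constant is declared with two
   different types.  Every well-formed global context satisfies this. *)
Definition global_context (G : gctx) : Prop :=
  (forall e, In e G -> entry_syntax e) /\
  (forall c U U', In (ODecl c U) G -> In (ODecl c U') G -> U = U') /\
  (forall C K K', In (TDecl C K) G -> In (TDecl C K') G -> K = K').

Inductive subterm_closure (R : relation expr) : relation expr :=
| sc_head t u : R t u -> subterm_closure R t u
| sc_app_l t t' u :
    subterm_closure R t t' -> subterm_closure R (App t u) (App t' u)
| sc_app_r t u u' :
    subterm_closure R u u' -> subterm_closure R (App t u) (App t u')
| sc_lam_l A A' t :
    subterm_closure R A A' -> subterm_closure R (Lam A t) (Lam A' t)
| sc_lam_r A t t' :
    subterm_closure R t t' -> subterm_closure R (Lam A t) (Lam A t')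
| sc_pi_l A A' B :
    subterm_closure R A A' -> subterm_closure R (Pi A B) (Pi A' B)
| sc_pi_r A B B' :
    subterm_closure R B B' -> subterm_closure R (Pi A B) (Pi A B').

(* The contracted redex is a term.  Hence head steps relate two objects or two
   types, and so no chain of steps, in either direction, leaves the grammar:
   conversion of terms only passes through terms. *)
Inductive beta_head : relation expr :=
| beta_redex A u v :
    is_term (App (Lam A u) v) -> beta_head (App (Lam A u) v) (subst1 u v).

Definition beta : relation expr := subterm_closure beta_head.

Inductive rule_head (G : gctx) : relation expr :=
| rule_instance u v sigma :
    In (Rule u v) G -> is_substitution sigma ->
    rule_head G (subst sigma u) (subst sigma v).

Definition rewrite (G : gctx) : relation expr := subterm_closure (rule_head G).

Definition step (G : gctx) : relation expr := union expr beta (rewrite G).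

Definition conv (G : gctx) : relation expr := clos_refl_sym_trans expr (step G).

Inductive typing (G : gctx) : lctx -> expr -> expr -> Prop :=
| ty_sort D : typing G D (Srt Type_) (Srt Kind_)
| ty_var D x A :
    nth_error D x = Some A -> typing G D (Var x) (lift (S x) A)
| ty_ocst D c A : In (ODecl c A) G -> typing G D (OC c) A
| ty_tcst D C A : In (TDecl C A) G -> typing G D (TC C) A
| ty_app D t u A B :
    typing G D t (Pi A B) -> typing G D u A ->
    typing G D (App t u) (subst1 B u)
| ty_lam D A t B :
    typing G D A (Srt Type_) -> typing G (A :: D) t B -> B <> Srt Kind_ ->
    typing G D (Lam A t) (Pi A B)
| ty_pi D A B s :
    typing G D A (Srt Type_) -> typing G (A :: D) B (Srt s) ->
    typing G D (Pi A B) (Srt s)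
| ty_conv D t A B s :
    typing G D t A -> typing G D B (Srt s) -> conv G A B -> typing G D t B.

Inductive wf_lctx (G : gctx) : lctx -> Prop :=
| wf_lctx_nil : wf_lctx G []
| wf_lctx_cons D U :
    wf_lctx G D -> typing G D U (Srt Type_) -> wf_lctx G (U :: D).

Definition PC (G : gctx) : Prop :=
  forall D A1 B1 A2 B2 T1 T2,
    wf_lctx G D ->
    typing G D (Pi A1 B1) T1 ->
    typing G D (Pi A2 B2) T2 ->
    conv G (Pi A1 B1) (Pi A2 B2) ->
    conv G A1 A2 /\ conv G B1 B2.

Definition well_typed_rule (G : gctx) (u v : expr) : Prop :=
  forall sigma D T,
    is_substitution sigma -> wf_lctx G D ->
    typing G D (subst sigma u) T -> typing G D (subst sigma v) T.

Definition permanently_well_typed (G : gctx) (u v : expr) : Prop :=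
  forall G0, global_context G0 -> incl G G0 -> PC G0 -> well_typed_rule G0 u v.

Definition odom (G : gctx) (c : OCst) : Prop := exists U, In (ODecl c U) G.

Definition tdom (G : gctx) (C : TCst) : Prop := exists K, In (TDecl C K) G.

Definition occurs_in_rules (c : OCst) (G : gctx) : Prop :=
  exists u v, In (Rule u v) G /\ (occurs c u \/ occurs c v).

(* A new object constant must not be mentioned by an earlier rule.  Without
   this, subject reduction fails: given A F N : Type, D : N -> Type and a : A,
   the rule (Pi x:A. D c) --> (Pi x:A. F) with c undeclared is permanently
   well-typed and keeps product compatibility, as c occurs in no well-typed
   term; after declaring c : N and d : D c, the term (lambda x:A. d) a has
   type F but reduces to d, which does not. *)
Inductive wf_gctx : gctx -> Prop :=
| wf_gctx_nil : wf_gctx []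
| wf_gctx_obj G c U :
    wf_gctx G -> typing G [] U (Srt Type_) ->
    ~ odom G c -> ~ occurs_in_rules c G ->
    wf_gctx (ODecl c U :: G)
| wf_gctx_type G C K :
    wf_gctx G -> typing G [] K (Srt Kind_) ->
    PC (TDecl C K :: G) -> ~ tdom G C ->
    wf_gctx (TDecl C K :: G)
| wf_gctx_rules G (rs : list (expr * expr)) :
    wf_gctx G ->
    (forall u v, In (u, v) rs ->
       rule_syntax u v /\ permanently_well_typed G u v) ->
    PC (map (fun r => Rule (fst r) (snd r)) (rev rs) ++ G) ->
    wf_gctx (map (fun r => Rule (fst r) (snd r)) (rev rs) ++ G).

End LambdaPiModulo.

(* Main.v *)
(** Subject reduction for beta needs product compatibility, and subject reduction
    for a rule needs the rule to be well-typed in the whole context; since rules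
    are permanently well-typed, both follow once PC(G) is known.  PC is imposed
    whenever a type constant or rules are added, so it has to be proved only for
    the empty context, by confluence of beta, and for the extension by an object
    constant c : U.  There, c occurs in no rule and in no earlier declaration, so
    replacing it by a fresh outermost variable of type U turns typing and
    conversion in the extended context into typing and conversion in G;
    substituting c back for the variable transports the conclusion. *)
From Stdlib Require Import List Relations Lia PeanoNat ClassicalEpsilon.
Require Import Defs.
Import ListNotations.

Set Implicit Arguments.

#[local] Arguments Var {OCst TCst} x.
#[local] Arguments OC {OCst TCst} c.
#[local] Arguments TC {OCst TCst} C.
#[local] Arguments Srt {OCst TCst} s.

Scheme is_object_mind := Minimality for is_object Sort Prop
  with is_type_mind := Minimality for is_type Sort Prop.
Combined Scheme object_type_mind from is_object_mind, is_type_mind.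

#[local] Hint Constructors is_object is_type is_kind subterm_closure : core.

Section LambdaPiModulo.

Context {OCst TCst : Type}.

Local Notation expr := (expr OCst TCst).
Local Notation lctx := (lctx OCst TCst).
Local Notation gctx := (gctx OCst TCst).

Implicit Types (t u v A B T U : expr) (D : lctx) (G : gctx) (c : OCst).
Implicit Types (f g : nat -> nat) (sigma tau : nat -> expr).

(** * Substitution *)

(** Renamings and substitutions are functions compared pointwise; under a binder, [up_ren] and [up]
    respect the laws below only up to pointwise equality. *)
Lemma rename_ext t : forall f g, (forall x, f x = g x) -> rename f t = rename g t.
Proof.
  induction t; simpl; intros f g H; f_equal; auto;
    apply IHt2; intros [|y]; simpl; auto.
Qed.

Lemma subst_ext t : forall sigma tau, (forall x, sigma x = tau x) ->
  subst sigma t = subst tau t.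
Proof.
  induction t; simpl; intros sigma tau H; f_equal; auto;
    apply IHt2; intros [|y]; simpl; unfold up; simpl; rewrite ?H; auto.
Qed.

Lemma rename_rename t : forall f g, rename f (rename g t) = rename (fun x => f (g x)) t.
Proof.
  induction t; simpl; intros f g; f_equal; auto;
    rewrite IHt2; apply rename_ext; intros [|y]; reflexivity.
Qed.

Lemma rename_as_subst t : forall f, rename f t = subst (fun x => Var (f x)) t.
Proof.
  induction t; simpl; intros f; f_equal; auto;
    rewrite IHt2; apply subst_ext; intros [|y]; reflexivity.
Qed.

Lemma subst_rename t : forall sigma f,
  subst sigma (rename f t) = subst (fun x => sigma (f x)) t.
Proof.
  induction t; simpl; intros sigma f; f_equal; auto;
    rewrite IHt2; apply subst_ext; intros [|y]; reflexivity.
Qed.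

Lemma rename_subst t : forall f sigma,
  rename f (subst sigma t) = subst (fun x => rename f (sigma x)) t.
Proof.
  induction t; simpl; intros f sigma; f_equal; auto;
    rewrite IHt2; apply subst_ext; intros [|y]; try reflexivity;
    unfold up, lift; simpl; rewrite !rename_rename; apply rename_ext; reflexivity.
Qed.

(** Last of the composition laws: [up] lifts by a renaming, so the binder case rests on both mixed
    laws, [subst_rename] and [rename_subst]. *)
Lemma subst_subst t : forall sigma tau,
  subst sigma (subst tau t) = subst (fun x => subst sigma (tau x)) t.
Proof.
  induction t; simpl; intros sigma tau; f_equal; auto;
    rewrite IHt2; apply subst_ext; intros [|y]; try reflexivity;
    unfold up, lift; simpl; rewrite subst_rename, rename_subst; reflexivity.
Qed.

Lemma subst_Var t : subst Var t = t.
Proof.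
  (* Generalized because [up Var] is only pointwise equal to [Var]. *)
  assert (H : forall sigma, (forall x, sigma x = Var x) -> subst sigma t = t).
  { induction t; simpl; intros sigma H; f_equal; auto;
      apply IHt2; intros [|y]; unfold up; simpl; rewrite ?H; reflexivity. }
  apply H; reflexivity.
Qed.

Lemma rename_lift_S f x A :
  rename (up_ren f) (lift (S x) A) = lift 1 (rename f (lift x A)).
Proof.
  unfold lift; rewrite !rename_rename; apply rename_ext; reflexivity.
Qed.

Lemma subst_up_lift sigma x A :
  subst (up sigma) (lift (S x) A) = lift 1 (subst sigma (lift x A)).
Proof.
  unfold lift; rewrite !subst_rename, rename_subst.
  apply subst_ext; reflexivity.
Qed.

Lemma subst1_lift u v : subst1 (lift 1 u) v = u.
Proof. unfold subst1, lift; rewrite subst_rename; apply subst_Var. Qed.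

Lemma subst_subst1 sigma B u :
  subst sigma (subst1 B u) = subst1 (subst (up sigma) B) (subst sigma u).
Proof.
  unfold subst1; rewrite !subst_subst; apply subst_ext; intros [|y]; simpl.
  - reflexivity.
  - symmetry; apply subst1_lift.
Qed.

Lemma rename_subst1 f B u :
  rename f (subst1 B u) = subst1 (rename (up_ren f) B) (rename f u).
Proof.
  rewrite !rename_as_subst, subst_subst1; f_equal.
  apply subst_ext; intros [|y]; reflexivity.
Qed.

Lemma closed_at_subst t : forall k sigma, closed_at k t ->
  (forall x, x < k -> sigma x = Var x) -> subst sigma t = t.
Proof.
  induction t; simpl; intros k sigma Hk H; try (f_equal; intuition eauto; fail);
    destruct Hk; f_equal; eauto; apply IHt2 with (S k); auto;
    intros [|y] Hy; unfold up; simpl; rewrite ?H by lia; reflexivity.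
Qed.

Lemma closed_subst sigma t : closed t -> subst sigma t = t.
Proof. intros H; apply closed_at_subst with 0; auto; lia. Qed.

Lemma closed_rename f t : closed t -> rename f t = t.
Proof. rewrite rename_as_subst; apply closed_subst. Qed.

(** * The grammar *)

Lemma object_type_disjoint t : is_object t -> ~ is_type t.
Proof.
  induction t; intros Ho Ht; inversion Ho; inversion Ht; subst; intuition.
Qed.

Lemma type_kind_disjoint t : is_type t -> ~ is_kind t.
Proof.
  induction t; intros Ht Hk; inversion Ht; inversion Hk; subst; intuition.
Qed.

Lemma object_not_kind t : is_object t -> ~ is_kind t.
Proof. intros Ho Hk; inversion Hk; subst; inversion Ho. Qed.

Lemma object_type_rename :
  (forall t, is_object t -> forall f, is_object (rename f t)) /\
  (forall t, is_type t -> forall f, is_type (rename f t)).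
Proof. apply object_type_mind; simpl; auto. Qed.

Lemma is_substitution_up sigma : is_substitution sigma -> is_substitution (up sigma).
Proof.
  intros H [|y]; unfold up; simpl; auto. apply object_type_rename; auto.
Qed.

Lemma is_substitution_scons v sigma :
  is_object v -> is_substitution sigma -> is_substitution (scons v sigma).
Proof. intros Hv H [|y]; simpl; auto. Qed.

Lemma is_substitution_Var f : is_substitution (fun x => Var (f x) : expr).
Proof. intros x; constructor. Qed.

Lemma object_type_subst :
  (forall t, is_object t -> forall sigma, is_substitution sigma -> is_object (subst sigma t)) /\
  (forall t, is_type t -> forall sigma, is_substitution sigma -> is_type (subst sigma t)).
Proof. apply object_type_mind; simpl; auto using is_substitution_up. Qed.

Lemma object_subst sigma t : is_substitution sigma -> is_object t -> is_object (subst sigma t).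
Proof. intros; apply object_type_subst; auto. Qed.

Lemma type_subst sigma t : is_substitution sigma -> is_type t -> is_type (subst sigma t).
Proof. intros; apply object_type_subst; auto. Qed.

Lemma kind_subst t : is_kind t ->
  forall sigma, is_substitution sigma -> is_kind (subst sigma t).
Proof. induction 1; simpl; auto using type_subst, is_substitution_up. Qed.

Lemma object_subst1 u v : is_object u -> is_object v -> is_object (subst1 u v).
Proof.
  intros; apply object_subst; auto.
  apply is_substitution_scons; auto; apply (is_substitution_Var (fun x => x)).
Qed.

Lemma type_subst1 u v : is_type u -> is_object v -> is_type (subst1 u v).
Proof.
  intros; apply type_subst; auto.
  apply is_substitution_scons; auto; apply (is_substitution_Var (fun x => x)).
Qed.

Lemma kind_subst1 u v : is_kind u -> is_object v -> is_kind (subst1 u v).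
Proof.
  intros; apply kind_subst; auto.
  apply is_substitution_scons; auto; apply (is_substitution_Var (fun x => x)).
Qed.

Lemma term_app_inv t u : is_term (App t u) ->
  is_object (App t u) \/ is_type (App t u).
Proof.
  intros [H|[H|[H|H]]]; auto; [inversion H | discriminate].
Qed.

Lemma term_app_subst sigma t u : is_substitution sigma ->
  is_term (App t u) -> is_term (subst sigma (App t u)).
Proof.
  intros Hs H; apply term_app_inv in H as [H|H].
  - left; apply object_subst; auto.
  - right; left; apply type_subst; auto.
Qed.

(** Equivalences rather than implications, so that the relation is symmetric and passes from [step]
    to [conv]. *)
Definition same_class t u : Prop :=
  (is_object t <-> is_object u) /\ (is_type t <-> is_type u) /\
  (is_kind t <-> is_kind u) /\ (t = Srt Kind_ <-> u = Srt Kind_).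

Lemma same_class_of_rule_syntax t u : rule_syntax t u -> same_class t u.
Proof.
  unfold same_class; intros [[Ht Hu]|[Ht Hu]].
  - pose proof (object_type_disjoint Ht); pose proof (object_type_disjoint Hu).
    pose proof (object_not_kind Ht); pose proof (object_not_kind Hu).
    intuition; subst; inversion Ht; inversion Hu.
  - assert (~ is_object t) by (intro Ho; exact (object_type_disjoint Ho Ht)).
    assert (~ is_object u) by (intro Ho; exact (object_type_disjoint Ho Hu)).
    pose proof (type_kind_disjoint Ht); pose proof (type_kind_disjoint Hu).
    intuition; subst; inversion Ht; inversion Hu.
Qed.

Lemma same_class_closure (R : relation expr) :
  (forall t u, R t u -> same_class t u) ->
  forall t u, subterm_closure R t u -> same_class t u.
Proof.
  intros HR t u H; induction H; auto; unfold same_class in *;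
    repeat split; intros E; try discriminate E; inversion E; subst;
    constructor; tauto.
Qed.

Definition rules_syntax G : Prop := forall u v, In (Rule u v) G -> rule_syntax u v.

Lemma rule_syntax_subst sigma u v : is_substitution sigma ->
  rule_syntax u v -> rule_syntax (subst sigma u) (subst sigma v).
Proof.
  intros Hs [[]|[]]; [left | right]; auto using object_subst, type_subst.
Qed.

(** The guard on redexes works here: an application that is a term has an object as argument, and
    substituting an object preserves the class of the body. *)
Lemma beta_head_syntax t u : beta_head t u -> rule_syntax t u.
Proof.
  intros [A u' v H]; apply term_app_inv in H as [H|H]; inversion H; subst.
  - left; split; auto. inversion H2; subst; auto using object_subst1.
  - right; split; auto. inversion H2; subst; auto using type_subst1.
Qed.

Lemma step_same_class G t u : rules_syntax G -> step G t u -> same_class t u.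
Proof.
  intros HG [H|H]; revert H; apply same_class_closure.
  - intros; apply same_class_of_rule_syntax, beta_head_syntax; auto.
  - intros ? ? []; apply same_class_of_rule_syntax, rule_syntax_subst; auto.
Qed.

(** Conversion never turns a type into a kind or into [Srt Kind_], although its intermediate
    expressions are untyped; this settles the conversion case of [typing_classes]. *)
Lemma conv_same_class G t u : rules_syntax G -> conv G t u -> same_class t u.
Proof.
  intros HG H; induction H; eauto using step_same_class;
    unfold same_class in *; tauto.
Qed.

(** * Conversion *)

Lemma subterm_closure_mono (R S : relation expr) :
  (forall t u, R t u -> S t u) ->
  forall t u, subterm_closure R t u -> subterm_closure S t u.
Proof. intros HRS t u H; induction H; auto. Qed.

Lemma subterm_closure_subst (R : relation expr) :
  (forall t u sigma, is_substitution sigma -> R t u -> R (subst sigma t) (subst sigma u)) ->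
  forall t u, subterm_closure R t u -> forall sigma, is_substitution sigma ->
  subterm_closure R (subst sigma t) (subst sigma u).
Proof.
  intros HR t u H; induction H; intros sigma Hs; simpl;
    auto using is_substitution_up.
Qed.

(** An object-valued substitution preserves the guard of [beta_head], and composes with the
    substitution of a rule instance to give another instance. *)
Lemma step_subst G t u sigma : is_substitution sigma ->
  step G t u -> step G (subst sigma t) (subst sigma u).
Proof.
  intros Hs [H|H]; [left | right]; revert t u H sigma Hs; apply subterm_closure_subst.
  - intros t u sigma Hs [A u' v H].
    rewrite subst_subst1; constructor.
    apply (term_app_subst Hs H).
  - intros t u sigma Hs [u' v tau Hin Ht].
    rewrite !subst_subst; constructor; auto.
    intros x; apply object_subst; auto.
Qed.

Lemma clos_rst_map (R S : relation expr) (F : expr -> expr) :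
  (forall t u, R t u -> S (F t) (F u)) ->
  forall t u, clos_refl_sym_trans _ R t u -> clos_refl_sym_trans _ S (F t) (F u).
Proof.
  intros HF t u H; induction H; eauto using clos_refl_sym_trans.
Qed.

Lemma conv_subst G t u sigma : is_substitution sigma ->
  conv G t u -> conv G (subst sigma t) (subst sigma u).
Proof. intros Hs; apply clos_rst_map; auto using step_subst. Qed.

Lemma conv_rename G t u f : conv G t u -> conv G (rename f t) (rename f u).
Proof. rewrite !rename_as_subst; apply conv_subst, is_substitution_Var. Qed.

Lemma conv_refl G t : conv G t t.
Proof. apply rst_refl. Qed.

Lemma conv_sym G t u : conv G t u -> conv G u t.
Proof. apply rst_sym. Qed.

Lemma conv_trans G t u v : conv G t u -> conv G u v -> conv G t v.
Proof. apply rst_trans. Qed.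

Lemma step_conv G t u : step G t u -> conv G t u.
Proof. apply rst_step. Qed.

Lemma conv_app G t t' u u' : conv G t t' -> conv G u u' -> conv G (App t u) (App t' u').
Proof.
  intros H1 H2; apply conv_trans with (App t' u).
  - revert H1; apply (clos_rst_map _ (fun t => App t u)).
    intros ? ? [H|H]; [left|right]; apply sc_app_l; assumption.
  - revert H2; apply (clos_rst_map _ (fun u => App t' u)).
    intros ? ? [H|H]; [left|right]; apply sc_app_r; assumption.
Qed.

Lemma conv_lam G t t' u u' : conv G t t' -> conv G u u' -> conv G (Lam t u) (Lam t' u').
Proof.
  intros H1 H2; apply conv_trans with (Lam t' u).
  - revert H1; apply (clos_rst_map _ (fun t => Lam t u)).
    intros ? ? [H|H]; [left|right]; apply sc_lam_l; assumption.
  - revert H2; apply (clos_rst_map _ (fun u => Lam t' u)).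
    intros ? ? [H|H]; [left|right]; apply sc_lam_r; assumption.
Qed.

Lemma conv_pi G t t' u u' : conv G t t' -> conv G u u' -> conv G (Pi t u) (Pi t' u').
Proof.
  intros H1 H2; apply conv_trans with (Pi t' u).
  - revert H1; apply (clos_rst_map _ (fun t => Pi t u)).
    intros ? ? [H|H]; [left|right]; apply sc_pi_l; assumption.
  - revert H2; apply (clos_rst_map _ (fun u => Pi t' u)).
    intros ? ? [H|H]; [left|right]; apply sc_pi_r; assumption.
Qed.

Lemma conv_subst_pointwise G t : forall sigma tau,
  (forall x, conv G (sigma x) (tau x)) -> conv G (subst sigma t) (subst tau t).
Proof.
  assert (Hup : forall sigma tau, (forall x, conv G (sigma x) (tau x)) ->
            forall x, conv G (up sigma x) (up tau x)).
  { intros sigma tau H [|y]; unfold up; simpl.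
    - apply conv_refl.
    - apply conv_rename, H. }
  induction t; simpl; intros sigma tau H; auto using conv_refl, conv_app, conv_lam, conv_pi.
Qed.

Lemma conv_subst1 G B u u' : conv G u u' -> conv G (subst1 B u) (subst1 B u').
Proof.
  intros H; apply conv_subst_pointwise; intros [|y]; simpl; auto using conv_refl.
Qed.

(** Conversion sees only the rules of a context, so declarations can be added or dropped. *)
Lemma conv_mono G G' t u :
  (forall u v, In (Rule u v) G -> In (Rule u v) G') -> conv G t u -> conv G' t u.
Proof.
  intros Hi; apply (clos_rst_map _ (fun t => t)).
  intros a b [H|H]; [left; assumption | right].
  revert H; apply subterm_closure_mono; intros ? ? []; constructor; auto.
Qed.

(** * Typing *)

Lemma typing_mono G G' D t T : incl G G' -> typing G D t T -> typing G' D t T.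
Proof.
  unfold incl; intros Hi H; induction H; try (econstructor; eauto; fail).
  eapply ty_conv; eauto using conv_mono.
Qed.

Lemma typing_closed_at G D t T : typing G D t T -> closed_at (length D) t.
Proof.
  intros H; induction H; simpl in *; auto.
  apply nth_error_Some; congruence.
Qed.

(** Applied to declared types, this shows that a constant new to [G] occurs in none of them. *)
Lemma typing_occurs G D t T c : typing G D t T -> occurs c t -> odom G c.
Proof.
  intros H; induction H; simpl; intros Ho; try tauto.
  subst; eexists; eauto.
Qed.

Lemma global_context_rules_syntax G : global_context G -> rules_syntax G.
Proof. intros [H _] u v Hin; apply (H _ Hin). Qed.

(** Stratification into objects, types and kinds. In an application the domain of the product is a
    type, which forces the argument to be an object, so substitution preserves the class of the
    codomain. *)
Lemma typing_classes G D t T : global_context G -> Forall (@is_type _ _) D ->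
  typing G D t T ->
  (is_object t /\ is_type T) \/ (is_type t /\ is_kind T) \/ (is_kind t /\ T = Srt Kind_).
Proof.
  intros HG HD H; induction H.
  - auto.
  - left; split; auto. apply object_type_rename.
    rewrite Forall_forall in HD; apply HD; eapply nth_error_In; eauto.
  - left; split; auto. apply HG in H; apply H.
  - right; left; split; auto. apply HG in H; apply H.
  - specialize (IHtyping1 HD); specialize (IHtyping2 HD).
    assert (Hu : is_type A -> is_object u).
    { intros HA; destruct IHtyping2 as [[]|[[]|[]]]; auto.
      - destruct (type_kind_disjoint HA); auto.
      - subst; inversion HA. }
    destruct IHtyping1 as [[Ho Ht]|[[Ho Ht]|[_ Ht]]]; [| |discriminate];
      inversion Ht; subst.
    + left; auto using type_subst1.
    + right; left; auto using kind_subst1.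
  - assert (HA : is_type A).
    { destruct (IHtyping1 HD) as [[_ HT]|[[]|[_ HT]]]; auto;
        [inversion HT | discriminate]. }
    destruct IHtyping2 as [[]|[[]|[]]]; auto; contradiction.
  - assert (HA : is_type A).
    { destruct (IHtyping1 HD) as [[_ HT]|[[]|[_ HT]]]; auto;
        [inversion HT | discriminate]. }
    destruct IHtyping2 as [[_ HT]|[[HB HT]|[HB HT]]]; auto.
    inversion HT.
  - assert (Hc : same_class A B)
      by eauto using conv_same_class, global_context_rules_syntax.
    unfold same_class in Hc; destruct (IHtyping1 HD) as [[]|[[]|[]]]; tauto.
Qed.

Lemma wf_lctx_types G D : global_context G -> wf_lctx G D -> Forall (@is_type _ _) D.
Proof.
  intros HG H; induction H; constructor; auto.
  destruct (typing_classes HG IHwf_lctx H0) as [[_ HT]|[[]|[_ HT]]]; auto;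
    [inversion HT | discriminate].
Qed.

Lemma typing_object G D t A : global_context G -> Forall (@is_type _ _) D ->
  typing G D t A -> is_type A -> is_object t.
Proof.
  intros HG HD Ht HA; destruct (typing_classes HG HD Ht) as [[]|[[]|[]]]; auto.
  - destruct (type_kind_disjoint HA); auto.
  - subst; inversion HA.
Qed.

Lemma typing_type G D A : global_context G -> Forall (@is_type _ _) D ->
  typing G D A (Srt Type_) -> is_type A.
Proof.
  intros HG HD HA; destruct (typing_classes HG HD HA) as [[_ HT]|[[]|[_ HT]]]; auto;
    [inversion HT | discriminate].
Qed.

(** The entry [A] lives in a tail of [D], where [f] does not act; the types are therefore compared
    after lifting to the full contexts. *)
Definition typed_renaming f D D' : Prop :=
  forall x A, nth_error D x = Some A ->
  exists A', nth_error D' (f x) = Some A' /\ lift (S (f x)) A' = rename f (lift (S x) A).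

Lemma typed_renaming_up f D D' A : typed_renaming f D D' ->
  typed_renaming (up_ren f) (A :: D) (rename f A :: D').
Proof.
  intros H [|x] A0 Hx; simpl in *.
  - injection Hx as ->; eexists; split; eauto.
    unfold lift; rewrite !rename_rename; apply rename_ext; reflexivity.
  - destruct (H x A0 Hx) as (A' & HA' & E); exists A'; split; auto.
    rewrite rename_lift_S, <- E; unfold lift; rewrite rename_rename.
    apply rename_ext; reflexivity.
Qed.

Lemma typing_rename G D t T : global_context G -> typing G D t T ->
  forall f D', typed_renaming f D D' -> typing G D' (rename f t) (rename f T).
Proof.
  intros HG H; induction H; intros f D' Hf; simpl.
  - constructor.
  - destruct (Hf x A H) as (A' & HA' & <-); constructor; auto.
  - rewrite closed_rename by apply (proj1 HG _ H); constructor; auto.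
  - rewrite closed_rename by apply (proj1 HG _ H); constructor; auto.
  - rewrite rename_subst1; eapply ty_app; [apply IHtyping1 | apply IHtyping2]; auto.
  - apply ty_lam; [apply IHtyping1; auto | apply IHtyping2, typed_renaming_up; auto |].
    destruct B; simpl; congruence.
  - apply ty_pi; [apply IHtyping1; auto | apply (IHtyping2 (up_ren f)), typed_renaming_up; auto].
  - eapply ty_conv; [apply IHtyping1; auto | apply IHtyping2; auto | apply conv_rename; auto].
Qed.

Lemma typing_weaken G D t T A : global_context G -> typing G D t T ->
  typing G (A :: D) (lift 1 t) (lift 1 T).
Proof.
  intros HG H; eapply typing_rename; eauto.
  intros x A0 Hx; exists A0; split; auto.
  unfold lift; rewrite rename_rename; reflexivity.
Qed.

Definition typed_substitution G sigma D D' : Prop :=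
  forall x A, nth_error D x = Some A -> typing G D' (sigma x) (subst sigma (lift (S x) A)).

Lemma typed_substitution_up G sigma D D' A : global_context G ->
  typed_substitution G sigma D D' ->
  typed_substitution G (up sigma) (A :: D) (subst sigma A :: D').
Proof.
  intros HG H [|x] A0 Hx; simpl in Hx.
  - injection Hx as ->; rewrite subst_up_lift.
    replace (lift 0 A0) with A0.
    + apply ty_var; reflexivity.
    + unfold lift; rewrite rename_as_subst; symmetry; apply subst_Var.
  - rewrite subst_up_lift; apply typing_weaken; auto.
Qed.

Lemma typing_subst G D t T : global_context G -> typing G D t T ->
  forall sigma D', is_substitution sigma -> typed_substitution G sigma D D' ->
  typing G D' (subst sigma t) (subst sigma T).
Proof.
  intros HG H; induction H; intros sigma D' Hs Hf; simpl.
  - constructor.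
  - apply Hf; auto.
  - rewrite closed_subst by apply (proj1 HG _ H); constructor; auto.
  - rewrite closed_subst by apply (proj1 HG _ H); constructor; auto.
  - rewrite subst_subst1; eapply ty_app; [apply IHtyping1 | apply IHtyping2]; auto.
  - apply ty_lam; [apply IHtyping1; auto
      | apply IHtyping2; auto using is_substitution_up, typed_substitution_up |].
    destruct B; simpl; try congruence.
    (* If [B] is a variable, its image is an object and hence not [Srt Kind_]. *)
    intros E; specialize (is_substitution_up Hs x); rewrite E; inversion 1.
  - apply ty_pi; [apply IHtyping1; auto |
      apply (IHtyping2 (up sigma)); auto using is_substitution_up, typed_substitution_up].
  - eapply ty_conv; [apply IHtyping1; auto | apply IHtyping2; auto | apply conv_subst; auto].
Qed.

Lemma typing_subst1 G D A t T v : global_context G -> is_object v ->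
  typing G (A :: D) t T -> typing G D v A -> typing G D (subst1 t v) (subst1 T v).
Proof.
  intros HG Hv Ht HvA; eapply typing_subst; eauto.
  - apply is_substitution_scons; auto; apply (is_substitution_Var (fun x => x)).
  - intros [|x] A0 Hx; simpl in Hx.
    + injection Hx as ->; fold (subst1 (lift 1 A0) v); rewrite subst1_lift; assumption.
    + replace (subst _ _) with (lift (S x) A0); [apply ty_var; auto|].
      unfold lift; rewrite subst_rename; simpl; apply rename_as_subst.
Qed.

(** The identity is a typed substitution between the two contexts: variable 0, declared with [A'],
    gets type [A] by conversion. *)
Lemma typing_context_conv G D A A' t T : global_context G ->
  typing G D A (Srt Type_) -> conv G A' A ->
  typing G (A :: D) t T -> typing G (A' :: D) t T.
Proof.
  intros HG HA Hc Ht; rewrite <- (subst_Var t), <- (subst_Var T).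
  eapply typing_subst; eauto.
  - apply (is_substitution_Var (fun x => x)).
  - intros [|x] A0 Hx; rewrite subst_Var; simpl in Hx.
    + injection Hx as ->; eapply ty_conv.
      * apply ty_var; reflexivity.
      * apply (typing_weaken A' HG HA).
      * apply conv_rename; auto.
    + apply ty_var; auto.
Qed.

(** * Inversion, correctness of types, and subject reduction under product compatibility *)

Lemma typing_lam_inv G D A t T : typing G D (Lam A t) T ->
  exists B, typing G D A (Srt Type_) /\ typing G (A :: D) t B /\ B <> Srt Kind_ /\
    conv G (Pi A B) T.
Proof.
  intros H; remember (Lam A t) as e eqn:E; induction H; inversion E; subst.
  - eauto using conv_refl.
  - destruct IHtyping1 as (B' & ? & ? & ? & ?); eauto 6 using conv_trans.
Qed.

Lemma typing_pi_inv G D A B T : typing G D (Pi A B) T ->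
  typing G D A (Srt Type_) /\ exists s, typing G (A :: D) B (Srt s).
Proof.
  intros H; remember (Pi A B) as e eqn:E; induction H; inversion E; subst; eauto.
Qed.

(** Typed in all of [G] rather than in the prefix before the declaration: this form is stable under
    extension by [typing_mono]. *)
Definition declarations_typed G : Prop :=
  (forall c U, In (ODecl c U) G -> typing G [] U (Srt Type_)) /\
  (forall C K, In (TDecl C K) G -> typing G [] K (Srt Kind_)).

Lemma typing_weaken_closed G D t s : global_context G ->
  typing G [] t (Srt s) -> typing G D t (Srt s).
Proof.
  intros HG Ht.
  rewrite <- (closed_rename (fun x => x) _ (typing_closed_at Ht)).
  change (Srt s) with (rename (fun x => x) (Srt s : expr)).
  apply (typing_rename HG Ht); intros [|x] A Hx; discriminate.
Qed.

Lemma typing_correct G D t T : global_context G -> declarations_typed G ->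
  wf_lctx G D -> typing G D t T ->
  T = Srt Kind_ \/ exists s, typing G D T (Srt s).
Proof.
  intros HG [HO HT] HD H; induction H.
  - auto.
  (* A declared type is well-typed in the tail behind it; each declaration in front weakens it by
     one. *)
  - right; exists Type_; revert x H; induction HD; intros [|x] Hx; try discriminate.
    + injection Hx as ->. apply (typing_weaken A HG H).
    + specialize (IHHD x Hx). apply (typing_weaken U HG) in IHHD.
      replace (lift (S (S x)) A) with (lift 1 (lift (S x) A)); [exact IHHD|].
      unfold lift; rewrite rename_rename; reflexivity.
  - right; exists Type_; apply typing_weaken_closed; eauto.
  - right; exists Kind_; apply typing_weaken_closed; eauto.
  - destruct (IHtyping1 HD) as [E|[s Hs]]; [discriminate|].
    apply typing_pi_inv in Hs as [HA [s' HB]].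
    right; exists s'; apply (typing_subst1 (T := Srt s') HG) with (2 := HB); auto.
    pose proof (wf_lctx_types HG HD).
    eapply typing_object; eauto using typing_type.
  - destruct IHtyping2 as [E|[s Hs]]; [constructor; auto | contradiction |].
    right; exists s; apply ty_pi; auto.
  - destruct s; [right; exists Kind_; constructor | auto].
  - eauto.
Qed.

(** Inversion gives the abstraction a type [Pi A B0] convertible to [Pi A' B]. Once both products
    are known to be well-typed, product compatibility yields a conversion of domains, which retypes
    [v], and one of codomains, which retypes the result. *)
Lemma typing_beta G D A u v A' B : global_context G -> declarations_typed G -> PC G ->
  wf_lctx G D -> typing G D (Lam A u) (Pi A' B) -> typing G D v A' ->
  typing G D (subst1 u v) (subst1 B v).
Proof.
  intros HG Hd HP HD Ht Hv.
  pose proof (wf_lctx_types HG HD) as HD'.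
  destruct (typing_correct HG Hd HD Ht) as [E|[s Hs]]; [discriminate|].
  destruct (typing_lam_inv Ht) as (B0 & HA & Hu & HB0 & Hc).
  destruct (typing_correct HG Hd (wf_lctx_cons HD HA) Hu) as [E|[s0 Hs0]]; [contradiction|].
  destruct (HP D A B0 A' B (Srt s0) (Srt s)) as [HcA HcB]; auto using ty_pi.
  assert (HvA : typing G D v A) by (eapply ty_conv; eauto using conv_sym).
  assert (Hvo : is_object v) by (eapply typing_object; eauto using typing_type).
  destruct (typing_pi_inv Hs) as [HA' [s1 HB]].
  eapply ty_conv.
  - eapply typing_subst1; eauto.
  - apply (typing_subst1 (T := Srt s1) HG Hvo HB Hv).
  - apply conv_subst; auto.
    apply is_substitution_scons; auto; apply (is_substitution_Var (fun x => x)).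
Qed.

(** With one closure of the union of head steps, each congruence case of subject reduction is
    treated once. *)
Lemma step_closure G t u :
  step G t u <-> subterm_closure (union _ (@beta_head _ _) (rule_head G)) t u.
Proof.
  split.
  - intros [H|H]; revert H; apply subterm_closure_mono; [left | right]; auto.
  - unfold step, beta, rewrite; intros H; induction H as [? ? [H|H]| | | | | |];
      try (destruct IHsubterm_closure); solve [left; auto | right; auto].
Qed.

Lemma subject_reduction_of_PC G D t1 t2 T :
  global_context G -> declarations_typed G -> PC G ->
  (forall u v, In (Rule u v) G -> well_typed_rule G u v) ->
  wf_lctx G D -> typing G D t1 T -> step G t1 t2 -> typing G D t2 T.
Proof.
  intros HG Hd HP HR HD H; revert t2.
  assert (Hconv : forall t u,
    subterm_closure (union _ (@beta_head _ _) (rule_head G)) t u -> conv G t u)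
    by (intros; apply step_conv, step_closure; auto).
  assert (Hrule : forall D t u T, wf_lctx G D -> typing G D t T -> rule_head G t u -> typing G D u T).
  { intros D0 t u T0 HD0 Ht Hr; destruct Hr as [u v sigma Hin Hs]; exact (HR _ _ Hin sigma D0 T0 Hs HD0 Ht). }
  intros t2 Ht2; apply step_closure in Ht2; revert t2 Ht2.
  induction H; intros t2 Hs.
  (* A leaf has no proper subterm and is no beta-redex, so only a rule instance at the root
     remains. *)
  - inversion Hs as [? ? [Hb|Hr]| | | | | |]; subst; [inversion Hb | ].
    eapply Hrule; eauto using typing.
  - inversion Hs as [? ? [Hb|Hr]| | | | | |]; subst; [inversion Hb | ].
    eapply Hrule; eauto using typing.
  - inversion Hs as [? ? [Hb|Hr]| | | | | |]; subst; [inversion Hb | ].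
    eapply Hrule; eauto using typing.
  - inversion Hs as [? ? [Hb|Hr]| | | | | |]; subst; [inversion Hb | ].
    eapply Hrule; eauto using typing.
  - inversion Hs as [? ? [Hb|Hr]| | | | | |]; subst.
    + inversion Hb; subst. eapply typing_beta; eauto.
    + eapply Hrule; eauto using typing.
    + eapply ty_app; eauto.
    (* Reducing the argument changes the type [subst1 B u]; converting back requires a sort for
       [subst1 B u]. *)
    + destruct (typing_correct HG Hd HD H) as [E|[s HPi]]; [discriminate|].
      apply typing_pi_inv in HPi as [HA [s' HB]].
      assert (Hu : is_object u)
        by (pose proof (wf_lctx_types HG HD); eapply typing_object; eauto using typing_type).
      eapply ty_conv; [eapply ty_app; eauto | | apply conv_subst1, conv_sym; auto].
      apply (typing_subst1 (T := Srt s') HG Hu HB); auto.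
  - assert (HD' : wf_lctx G (A :: D)) by (constructor; auto).
    destruct (typing_correct HG Hd HD' H0) as [E|[s HB]]; [contradiction|].
    inversion Hs as [? ? [Hb|Hr]| | | | | |]; subst; [inversion Hb | | | ].
    + eapply Hrule; eauto using typing.
    (* When the annotation reduces, the body is retyped in the converted context and the new product
       is converted back to [Pi A B]. *)
    + eapply ty_conv.
      * apply ty_lam; [apply IHtyping1; eauto | | eauto].
        eapply typing_context_conv; eauto using conv_sym.
      * apply ty_pi; eauto.
      * apply conv_pi; auto using conv_refl, conv_sym.
    + apply ty_lam; auto.
  - assert (HD' : wf_lctx G (A :: D)) by (constructor; auto).
    inversion Hs as [? ? [Hb|Hr]| | | | | |]; subst; [inversion Hb | | | ].
    + eapply Hrule; eauto using typing.
    + apply ty_pi; auto.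
      eapply typing_context_conv; eauto using conv_sym.
    + apply ty_pi; auto.
  - eapply ty_conv; eauto.
Qed.

(** * Confluence of beta-reduction *)

(** Tait and Martin-Löf's parallel reduction, without the guard of [beta_head]: confluence is proved
    on all raw expressions, and the guard is recovered afterwards. *)
Inductive par : relation expr :=
| par_refl t : par t t
| par_app t t' u u' : par t t' -> par u u' -> par (App t u) (App t' u')
| par_lam A A' t t' : par A A' -> par t t' -> par (Lam A t) (Lam A' t')
| par_pi A A' B B' : par A A' -> par B B' -> par (Pi A B) (Pi A' B')
| par_beta A u u' v v' : par u u' -> par v v' ->
    par (App (Lam A u) v) (subst1 u' v').

(** Takahashi's complete development, contracting every redex of [t] at once. *)
Fixpoint develop t : expr :=
  match t with
  | App (Lam _ u) v => subst1 (develop u) (develop v)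
  | App t u => App (develop t) (develop u)
  | Lam A t => Lam (develop A) (develop t)
  | Pi A B => Pi (develop A) (develop B)
  | _ => t
  end.

Lemma par_rename t u : par t u -> forall f, par (rename f t) (rename f u).
Proof.
  intros H; induction H; intros f; simpl; auto using par.
  rewrite rename_subst1; auto using par.
Qed.

Lemma par_up sigma tau : (forall x, par (sigma x) (tau x)) ->
  forall x, par (up sigma x) (up tau x).
Proof.
  intros H [|x]; unfold up; simpl; [apply par_refl | apply par_rename, H].
Qed.

(** Covers the [par_refl] case of [par_subst], where only the substitutions reduce. *)
Lemma par_subst_refl t : forall sigma tau, (forall x, par (sigma x) (tau x)) ->
  par (subst sigma t) (subst tau t).
Proof.
  induction t; simpl; intros; auto using par, par_up.
Qed.

Lemma par_subst t u : par t u -> forall sigma tau,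
  (forall x, par (sigma x) (tau x)) -> par (subst sigma t) (subst tau u).
Proof.
  intros H; induction H; intros sigma tau Hs; simpl; auto using par, par_up, par_subst_refl.
  rewrite subst_subst1; auto using par, par_up.
Qed.

Lemma par_subst1 u u' v v' : par u u' -> par v v' -> par (subst1 u v) (subst1 u' v').
Proof.
  intros Hu Hv; apply par_subst; auto; intros [|x]; simpl; auto using par.
Qed.

Lemma par_lam_inv A t u : par (Lam A t) u ->
  exists A' t', u = Lam A' t' /\ par A A' /\ par t t'.
Proof. intros H; inversion H; subst; eauto using par. Qed.

Lemma par_develop_refl t : par t (develop t).
Proof.
  induction t; simpl; auto using par.
  destruct t1; auto using par.
  apply par_lam_inv in IHt1 as (A' & t' & E & ? & ?); injection E as <- <-.
  auto using par.
Qed.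

(** The triangle property: [develop t] is a common reduct of all one-step parallel reducts of
    [t]. *)
Lemma par_develop t u : par t u -> par u (develop t).
Proof.
  intros H; induction H; try apply par_develop_refl; simpl; auto using par, par_subst1.
  destruct t; auto using par.
  apply par_lam_inv in H as (A' & t'' & -> & _ & _).
  apply par_lam_inv in IHpar1 as (A'' & t''' & E & _ & ?); injection E as <- <-.
  auto using par.
Qed.

Lemma par_confluent t u v : clos_refl_trans_1n _ par t u -> clos_refl_trans_1n _ par t v ->
  exists w, clos_refl_trans_1n _ par u w /\ clos_refl_trans_1n _ par v w.
Proof.
  assert (Hstrip : forall t u, clos_refl_trans_1n _ par t u -> forall v, par t v ->
     exists w, par u w /\ clos_refl_trans_1n _ par v w).
  { clear; intros t u H; induction H as [t|t t' u Ht _ IH]; intros v Hv.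
    - exists v; split; auto; constructor.
    (* Both [t'] and [v] reduce to [develop t], which closes this square. *)
    - destruct (IH (develop t)) as (w & ? & ?); [apply par_develop; auto|].
      exists w; split; auto. econstructor; [apply par_develop; exact Hv | auto]. }
  intros Hu Hv; revert u Hu; induction Hv as [t|t t' v Ht _ IH]; intros u Hu.
  - exists u; split; auto; constructor.
  - destruct (Hstrip _ _ Hu _ Ht) as (w & Huw & Ht'w).
    destruct (IH _ Ht'w) as (w' & ? & ?).
    exists w'; split; auto. econstructor; eauto.
Qed.

Lemma beta_par t u : beta t u -> par t u.
Proof.
  intros H; induction H as [? ? []| | | | | |]; auto using par.
Qed.

(** Church-Rosser: without rules every step is a beta step, and confluence joins the zigzags. *)
Lemma conv_nil_joinable t u : conv [] t u ->
  exists w, clos_refl_trans_1n _ par t w /\ clos_refl_trans_1n _ par u w.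
Proof.
  intros H; induction H as [t u [H|H]| |t u _ (w & ? & ?)|t u v _ (w1 & H1 & H2) _ (w2 & H3 & H4)].
  - exists u; split; [|constructor]. econstructor; [apply beta_par; eauto | constructor].
  - exfalso; induction H as [? ? [? ? ? []]| | | | | |]; auto.
  - exists x; split; constructor.
  - eauto.
  - destruct (par_confluent H2 H3) as (w & ? & ?).
    exists w; split; apply clos_rt_rt1n; eapply rt_trans; apply clos_rt1n_rt; eauto.
Qed.

(* Reduction from a term is never stopped by the guard of [beta_head], since
   every applied subexpression of a term is an object or a type. *)
Lemma par_object_type_conv G t u : par t u ->
  (is_object t -> is_object u /\ conv G t u) /\ (is_type t -> is_type u /\ conv G t u).
Proof.
  intros H; induction H; split; intros Ht; auto using conv_refl;
    inversion Ht; subst; intuition auto using conv_app, conv_lam, conv_pi.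
  all: inversion H3; subst; intuition auto using object_subst1, type_subst1.
  (* Body and argument are reduced first; the redex contracted last is then still an object or a
     type, so it passes the guard. *)
  all: eapply conv_trans; [apply conv_app; [apply conv_lam; [apply conv_refl|eassumption]|eassumption]|].
  all: apply step_conv; left; apply sc_head; constructor.
  - left; auto.
  - right; left; auto.
Qed.

Lemma par_kind_conv G t u : par t u -> is_kind t -> is_kind u /\ conv G t u.
Proof.
  intros H; induction H; intros Ht; auto using conv_refl; inversion Ht; subst.
  destruct (proj2 (par_object_type_conv G H)); auto.
  destruct IHpar2; auto using conv_pi.
Qed.

Lemma pars_conv G t u : clos_refl_trans_1n _ par t u ->
  is_type t \/ is_kind t -> conv G t u.
Proof.
  intros H; induction H as [t|t t' u Ht _ IH]; intros Hc; [apply conv_refl|].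
  apply conv_trans with t'.
  - destruct Hc as [Hc|Hc];
      [apply (proj2 (par_object_type_conv G Ht) Hc) | apply (par_kind_conv G Ht Hc)].
  - apply IH; destruct Hc as [Hc|Hc];
      [left; apply (proj2 (par_object_type_conv G Ht) Hc)
      | right; apply (par_kind_conv G Ht Hc)].
Qed.

Lemma pars_pi_inv A B t : clos_refl_trans_1n _ par (Pi A B) t ->
  exists A' B', t = Pi A' B' /\
    clos_refl_trans_1n _ par A A' /\ clos_refl_trans_1n _ par B B'.
Proof.
  intros H; remember (Pi A B) as e eqn:E; revert A B E.
  induction H as [t|t t' u Ht _ IH]; intros A B ->.
  - exists A, B; repeat split; constructor.
  - inversion Ht; subst.
    + apply IH; reflexivity.
    + destruct (IH _ _ eq_refl) as (A'' & B'' & -> & ? & ?).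
      exists A'', B''; repeat split; econstructor; eauto.
Qed.

Lemma typing_pi_syntax G D A B T : global_context G -> Forall (@is_type _ _) D ->
  typing G D (Pi A B) T -> is_type A /\ (is_type B \/ is_kind B).
Proof.
  intros HG HD H; destruct (typing_classes HG HD H) as [[HP _]|[[HP _]|[HP _]]];
    inversion HP; auto.
Qed.

Lemma global_context_nil : global_context ([] : gctx).
Proof. repeat split; intros; contradiction. Qed.

(** A product reduces only to products, componentwise, so the common reduct joins domains and
    codomains separately. These are types or kinds, on which parallel reduction is included in
    [conv]. *)
Lemma PC_nil : PC ([] : gctx).
Proof.
  intros D A1 B1 A2 B2 T1 T2 HD H1 H2 Hc.
  pose proof (wf_lctx_types global_context_nil HD) as HD'.
  destruct (typing_pi_syntax global_context_nil HD' H1) as [HA1 HB1].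
  destruct (typing_pi_syntax global_context_nil HD' H2) as [HA2 HB2].
  destruct (conv_nil_joinable Hc) as (w & Hw1 & Hw2).
  destruct (pars_pi_inv Hw1) as (A & B & -> & ? & ?).
  destruct (pars_pi_inv Hw2) as (A' & B' & E & ? & ?).
  injection E as <- <-.
  split; (eapply conv_trans; [|apply conv_sym]); eapply pars_conv; eauto.
Qed.

(** * Replacing a constant by a variable *)

(** The index [n] grows under binders so as to denote the same outer variable. Constants form an
    arbitrary type, hence the classical test of equality. *)
Fixpoint abstract_cst c (n : nat) t : expr :=
  match t with
  | OC d => if excluded_middle_informative (d = c) then Var n else OC d
  | Var _ | TC _ | Srt _ => t
  | App t u => App (abstract_cst c n t) (abstract_cst c n u)
  | Lam A t => Lam (abstract_cst c n A) (abstract_cst c (S n) t)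
  | Pi A B => Pi (abstract_cst c n A) (abstract_cst c (S n) B)
  end.

Lemma abstract_cst_id c t : forall n, ~ occurs c t -> abstract_cst c n t = t.
Proof.
  induction t; simpl; intros n H; f_equal; auto.
  destruct (excluded_middle_informative _); congruence.
Qed.

Lemma abstract_cst_rename c t : forall n f,
  abstract_cst c (f n) (rename f t) = rename f (abstract_cst c n t).
Proof.
  induction t; simpl; intros n f; f_equal; auto;
    try (destruct (excluded_middle_informative _); reflexivity);
    apply (IHt2 (S n) (up_ren f)).
Qed.

(** The condition says that [sigma] sends the variable replacing [c] in [t] to the one replacing it
    in the result. It is vacuous when [c] does not occur in [t], as for the two sides of a rule. *)
Lemma abstract_cst_subst c t : forall n m sigma,
  (occurs c t -> sigma n = Var m) ->
  abstract_cst c m (subst sigma t) =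
  subst (fun x => abstract_cst c m (sigma x)) (abstract_cst c n t).
Proof.
  assert (Hup : forall m sigma t,
    subst (fun x => abstract_cst c (S m) (up sigma x)) t =
    subst (up (fun x => abstract_cst c m (sigma x))) t).
  { intros; apply subst_ext; intros [|x]; unfold up; simpl; auto.
    apply (abstract_cst_rename c (sigma x) m S). }
  assert (Hn : forall n m sigma, sigma n = Var m -> up sigma (S n) = Var (S m))
    by (intros n m sigma E; unfold up; simpl; rewrite E; reflexivity).
  induction t; simpl; intros n m sigma H; f_equal; auto.
  - destruct (excluded_middle_informative _); auto.
    simpl; rewrite H; auto.
  - rewrite IHt2 with (n := S n); auto.
  - rewrite IHt2 with (n := S n); auto.
Qed.

Lemma abstract_cst_subst1 c n B u :
  abstract_cst c n (subst1 B u) = subst1 (abstract_cst c (S n) B) (abstract_cst c n u).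
Proof.
  unfold subst1; rewrite abstract_cst_subst with (n := S n) by reflexivity.
  apply subst_ext; intros [|x]; reflexivity.
Qed.

Lemma abstract_cst_object_type c :
  (forall t, is_object t -> forall n, is_object (abstract_cst c n t)) /\
  (forall t, is_type t -> forall n, is_type (abstract_cst c n t)).
Proof.
  apply object_type_mind; simpl; auto; intros.
  destruct (excluded_middle_informative _); auto.
Qed.

(** A rule instance can contain [c] only through its substitution, so abstracting the values of the
    substitution gives another instance of the same rule. *)
Lemma abstract_cst_conv G c n t u : ~ occurs_in_rules c G ->
  conv G t u -> conv G (abstract_cst c n t) (abstract_cst c n u).
Proof.
  intros Hc; apply clos_rst_map; clear t u.
  assert (Hcl : forall R : relation expr,
    (forall n t u, R t u -> R (abstract_cst c n t) (abstract_cst c n u)) ->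
    forall t u, subterm_closure R t u -> forall n,
    subterm_closure R (abstract_cst c n t) (abstract_cst c n u)).
  { intros R HR t u H; induction H; intros m; simpl; auto. }
  intros t u [H|H]; [left | right]; revert t u H n; apply Hcl; intros n.
  - intros t u [A u' v H]; rewrite abstract_cst_subst1; constructor.
    apply term_app_inv in H as [H|H]; [left | right; left];
      apply (proj1 (abstract_cst_object_type c)) with (n := n) in H
      || apply (proj2 (abstract_cst_object_type c)) with (n := n) in H; exact H.
  - intros t u [u' v sigma Hin Hs].
    assert (Hu : ~ occurs c u') by (intros Ho; apply Hc; exists u', v; auto).
    assert (Hv : ~ occurs c v) by (intros Ho; apply Hc; exists u', v; auto).
    (* The index 0 is arbitrary, since [c] occurs in neither side. *)
    rewrite !abstract_cst_subst with (n := 0) by tauto.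
    rewrite !abstract_cst_id by assumption.
    constructor; auto; intros x; apply abstract_cst_object_type; auto.
Qed.

(** Closedness at [n] ensures that variable [n] of the abstracted term stands only for [c]. *)
Lemma subst_abstract_cst c t : forall n sigma, closed_at n t ->
  (forall x, x < n -> sigma x = Var x) -> sigma n = OC c ->
  subst sigma (abstract_cst c n t) = t.
Proof.
  induction t; simpl; intros n sigma Ht Hlt Hn; try (f_equal; intuition eauto; fail).
  - destruct (excluded_middle_informative _); simpl; congruence.
  - destruct Ht; f_equal; auto. apply IHt2; auto.
    + intros [|x] Hx; unfold up; simpl; rewrite ?Hlt by lia; reflexivity.
    + unfold up; simpl; rewrite Hn; reflexivity.
  - destruct Ht; f_equal; auto. apply IHt2; auto.
    + intros [|x] Hx; unfold up; simpl; rewrite ?Hlt by lia; reflexivity.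
    + unfold up; simpl; rewrite Hn; reflexivity.
Qed.

Lemma abstract_cst_conv_inv G c n t u : closed_at n t -> closed_at n u ->
  conv G (abstract_cst c n t) (abstract_cst c n u) -> conv G t u.
Proof.
  intros Ht Hu H.
  set (sigma x := if Nat.eq_dec x n then OC c else Var x : expr).
  assert (Hs : is_substitution sigma)
    by (intros x; unfold sigma; destruct (Nat.eq_dec x n); auto).
  assert (Hlt : forall x, x < n -> sigma x = Var x)
    by (intros x Hx; unfold sigma; destruct (Nat.eq_dec x n); auto; lia).
  assert (Hn : sigma n = OC c)
    by (unfold sigma; destruct (Nat.eq_dec n n); auto; lia).
  apply (conv_subst Hs) in H.
  rewrite !subst_abstract_cst in H by assumption; exact H.
Qed.

(* The constant becomes the outermost variable, whose de Bruijn index in [D]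
   is [length D], so that no other index moves. *)
Fixpoint abstract_lctx c U D : lctx :=
  match D with
  | [] => [U]
  | A :: D => abstract_cst c (length D) A :: abstract_lctx c U D
  end.

(** Behind entry [x] there remain [length D - S x] declarations, which is the index of the new
    variable as seen from its type. *)
Lemma nth_abstract_lctx c U D : forall x A, nth_error D x = Some A ->
  nth_error (abstract_lctx c U D) x = Some (abstract_cst c (length D - S x) A).
Proof.
  induction D as [|A0 D IH]; intros [|x] A Hx; try discriminate; simpl in *.
  - injection Hx as ->; rewrite Nat.sub_0_r; reflexivity.
  - apply IH; assumption.
Qed.

Lemma nth_abstract_lctx_last c U D :
  nth_error (abstract_lctx c U D) (length D) = Some U.
Proof. induction D; simpl; auto. Qed.

Lemma typing_abstract_cst G c U D t T :
  global_context G -> declarations_typed G ->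
  typing G [] U (Srt Type_) -> ~ odom G c -> ~ occurs_in_rules c G ->
  typing (ODecl c U :: G) D t T ->
  typing G (abstract_lctx c U D) (abstract_cst c (length D) t) (abstract_cst c (length D) T).
Proof.
  intros HG [HO HT] HU Hc Hr H; induction H; simpl in *.
  - constructor.
  - assert (Hx : x < length D) by (apply nth_error_Some; congruence).
    (* In this form the index is the image of [length D - S x] under the lifting, so
       [abstract_cst_rename] applies. *)
    replace (length D) with (S x + (length D - S x)) at 1 by lia.
    unfold lift; rewrite abstract_cst_rename.
    apply ty_var, nth_abstract_lctx; assumption.
  - assert (HA : typing G [] A (Srt Type_))
      by (destruct H as [H|H]; [injection H as -> ->|]; eauto).
    (* The declared type is typed in [G], where [c] is undeclared, so it does not mention [c]. *)
    rewrite (abstract_cst_id c A) by (intros Ho; eauto using typing_occurs).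
    destruct (excluded_middle_informative _) as [->|Hne].
    + destruct H as [H|H]; [injection H as -> | destruct Hc; exists A; auto].
      (* The constant [c] itself becomes the outermost variable; its type is closed, so lifting
         leaves it unchanged. *)
      pose proof (ty_var G _ _ (nth_abstract_lctx_last c A D)) as Hv.
      unfold lift in Hv; rewrite closed_rename in Hv by apply (typing_closed_at HU).
      exact Hv.
    + apply ty_ocst; destruct H as [H|H]; [congruence | auto].
  - destruct H as [H|H]; [discriminate|].
    rewrite (abstract_cst_id c A) by (intros Ho; eauto using typing_occurs).
    apply ty_tcst; auto.
  - rewrite abstract_cst_subst1; eapply ty_app; eauto.
  - apply ty_lam; auto.
    destruct B; simpl; try congruence.
    destruct (excluded_middle_informative _); discriminate.
  - apply ty_pi; auto.
  - eapply ty_conv; eauto.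
    apply abstract_cst_conv; auto.
    revert H1; apply conv_mono; intros u v [E|Hin]; [discriminate | auto].
Qed.

Lemma wf_abstract_lctx G c U D :
  global_context G -> declarations_typed G ->
  typing G [] U (Srt Type_) -> ~ odom G c -> ~ occurs_in_rules c G ->
  wf_lctx (ODecl c U :: G) D -> wf_lctx G (abstract_lctx c U D).
Proof.
  intros HG Hd HU Hc Hr H; induction H; simpl; constructor; auto.
  - constructor.
  - apply (typing_abstract_cst HG Hd HU Hc Hr H0).
Qed.

Lemma PC_ODecl G c U :
  global_context G -> declarations_typed G ->
  typing G [] U (Srt Type_) -> ~ odom G c -> ~ occurs_in_rules c G ->
  PC G -> PC (ODecl c U :: G).
Proof.
  intros HG Hd HU Hc Hr HP D A1 B1 A2 B2 T1 T2 HD H1 H2 Hcv.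
  (* Closedness at [length D] for domains, and one more for codomains, will allow [c] to be
     substituted back. *)
  destruct (typing_closed_at H1) as [HA1 HB1].
  destruct (typing_closed_at H2) as [HA2 HB2].
  assert (Hcv' : conv G (Pi A1 B1) (Pi A2 B2)).
  { revert Hcv; apply conv_mono; intros u v [E|Hin]; [discriminate | auto]. }
  apply (abstract_cst_conv (length D) Hr) in Hcv'.
  apply (typing_abstract_cst HG Hd HU Hc Hr) in H1, H2.
  destruct (HP _ _ _ _ _ _ _ (wf_abstract_lctx HG Hd HU Hc Hr HD) H1 H2 Hcv') as [HcA HcB].
  apply abstract_cst_conv_inv in HcA, HcB; auto.
  assert (Hm : forall t u, conv G t u -> conv (ODecl c U :: G) t u)
    by (intros t u; apply conv_mono; intros; right; auto).
  auto.
Qed.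

(** * Well-formed global contexts *)

Lemma wf_gctx_invariants G : wf_gctx G ->
  global_context G /\ declarations_typed G /\ PC G /\
  forall u v, In (Rule u v) G -> permanently_well_typed G u v.
Proof.
  (* Permanence quantifies over all extensions, and those of [G'] are among those of [G]. *)
  assert (Hperm : forall G G' u v, incl G G' ->
    permanently_well_typed G u v -> permanently_well_typed G' u v).
  { intros G1 G2 u v Hi Hp G0 HG0 Hi0; apply Hp; auto; eapply incl_tran; eauto. }
  intros H; induction H as [|G c U _ (HG & Hd & HP & HR) HU Hc Hr
    |G C K _ (HG & Hd & HP & HR) HK HPC HC|G rs _ (HG & Hd & HP & HR) Hrs HPC].
  - split; [apply global_context_nil|]. split; [split; intros; contradiction|].
    split; [apply PC_nil | intros; contradiction].
  - assert (Hi : incl G (ODecl c U :: G)) by (apply incl_tl, incl_refl).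
    split; [|split; [|split]].
    + destruct HG as (He & Ho & Ht); split; [|split].
      * intros e [<-|Hin]; auto. split; [|apply (typing_closed_at HU)].
        apply (typing_type (conj He (conj Ho Ht)) (Forall_nil _) HU).
      * intros c' V V' [E|Hin] [E'|Hin']; [congruence | | |eauto].
        -- injection E as -> ->; destruct Hc; exists V'; auto.
        -- injection E' as -> ->; destruct Hc; exists V; auto.
      * intros C V V' [E|Hin] [E'|Hin']; try discriminate; eauto.
    + destruct Hd as [Ho Ht]; split.
      * intros c' V [E|Hin]; [injection E as -> ->|]; eauto using typing_mono.
      * intros C V [E|Hin]; [discriminate|]; eauto using typing_mono.
    (* The constructor for object constants does not provide product compatibility, so it is
       transferred from [G]. *)
    + apply PC_ODecl; auto.
    + intros u v [E|Hin]; [discriminate | eauto].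
  - assert (Hi : incl G (TDecl C K :: G)) by (apply incl_tl, incl_refl).
    split; [|split; [|split]]; auto.
    + assert (HKk : is_kind K).
      { destruct (typing_classes HG (Forall_nil _) HK) as [[_ HT]|[[_ HT]|[]]]; auto;
          inversion HT. }
      destruct HG as (He & Ho & Ht); split; [|split].
      * intros e [<-|Hin]; auto. split; [auto | apply (typing_closed_at HK)].
      * intros c' V V' [E|Hin] [E'|Hin']; try discriminate; eauto.
      * intros C' V V' [E|Hin] [E'|Hin']; [congruence | | |eauto].
        -- injection E as -> ->; destruct HC; exists V'; auto.
        -- injection E' as -> ->; destruct HC; exists V; auto.
    + destruct Hd as [Ho Ht]; split.
      * intros c' V [E|Hin]; [discriminate|]; eauto using typing_mono.
      * intros C' V [E|Hin]; [injection E as -> ->|]; eauto using typing_mono.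
    + intros u v [E|Hin]; [discriminate | eauto].
  - set (G' := map (fun r => Rule (fst r) (snd r)) (rev rs)).
    (* Only rules are added, so every declaration comes from [G]. *)
    assert (HG' : forall e, In e (G' ++ G) ->
      (exists u v, e = Rule u v /\ In (u, v) rs) \/ In e G).
    { intros e He; apply in_app_or in He as [He|He]; auto; left.
      apply in_map_iff in He as ([u v] & <- & Hin).
      exists u, v; rewrite in_rev; auto. }
    assert (Hi : incl G (G' ++ G)) by (apply incl_appr, incl_refl).
    split; [|split; [|split]]; auto.
    + destruct HG as (He & Ho & Ht); split; [|split].
      * intros e Hin; apply HG' in Hin as [(u & v & -> & Hin)|Hin]; auto.
        apply (Hrs _ _ Hin).
      * intros c V V' Hin Hin'.
        apply HG' in Hin as [(u & v & E & _)|Hin]; [discriminate|].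
        apply HG' in Hin' as [(u & v & E & _)|Hin']; [discriminate | eauto].
      * intros C V V' Hin Hin'.
        apply HG' in Hin as [(u & v & E & _)|Hin]; [discriminate|].
        apply HG' in Hin' as [(u & v & E & _)|Hin']; [discriminate | eauto].
    + destruct Hd as [Ho Ht]; split; intros c V Hin;
        apply HG' in Hin as [(u & v & E & _)|Hin]; try discriminate;
        eauto using typing_mono.
    + intros u v Hin; apply HG' in Hin as [(u' & v' & E & Hin)|Hin]; [|eauto].
      injection E as -> ->; apply (Hperm G); auto; apply Hrs; auto.
Qed.

End LambdaPiModulo.

Theorem mainTheorem1 (OCst TCst : Type)
  (OCst_infinite : infinite OCst) (TCst_infinite : infinite TCst)
  (G : gctx OCst TCst) (HG : wf_gctx G)
  (t1 t2 T : expr OCst TCst) (D : lctx OCst TCst) :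
  wf_lctx G D -> typing G D t1 T -> step G t1 t2 -> typing G D t2 T.
Proof.
  destruct (wf_gctx_invariants HG) as (HGc & Hd & HP & HR).
  apply subject_reduction_of_PC; auto.
  (* Permanence is instantiated at [G] itself, which satisfies [PC]. *)
  intros u v Hin; apply (HR u v Hin); auto using incl_refl.
Qed.
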